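(* Let $I,J\subseteq\mathbb{R}$ be intervals with $(0,1)\subset J$, and let $h:J\to[0,\infty)$ be a function with $h\neq 0$, $h\in L[0,1]$ and $h(\tfrac12)\ne 0$. Let $f:I\to\mathbb{R}$ be differentiable on the interior $I^{\circ}$ of $I$, let $a,b\in I^{\circ}$ with $a<b$, suppose $f'\in L[a,b]$, and let $\alpha,\lambda\in[0,1]$, $q>1$ and $\frac1p+\frac1q=1$. If $|f'|^{q}$ is $h$-concave on $[a,b]$, then $$\left|\lambda\left(\alpha f(a)+(1-\alpha)f(b)\right)+(1-\lambda)f(\alpha a+(1-\alpha)b)-\frac{1}{b-a}\int_a^b f(x)\,dx\right|$$ $$\le(b-a)\left(\frac{1}{2h(\frac12)}\right)^{\frac1q}\left(\frac{1}{p+1}\right)^{\frac1p}\cdot\begin{cases}\varepsilon_1^{\frac1p}E^{\frac1q}+\varepsilon_3^{\frac1p}F^{\frac1q}, & \alpha\lambda\le 1-\alpha\le 1-\lambda(1-\alpha),\\ \varepsilon_1^{\frac1p}E^{\frac1q}+\varepsilon_4^{\frac1p}F^{\frac1q}, & \alpha\lambda\le 1-\lambda(1-\alpha)\le 1-\alpha,\\ \varepsilon_2^{\frac1p}E^{\frac1q}+\varepsilon_3^{\frac1p}F^{\frac1q}, & 1-\alpha\le\alpha\lambda\le 1-\lambda(1-\alpha),\end{cases}$$ where $$E=(1-\alpha)\left|f'\left(\frac{(1-\alpha)b+(1+\alpha)a}{2}\right)\right|^q,\qquad F=\alpha\left|f'\left(\frac{(2-\alpha)b+\alpha a}{2}\right)\right|^q,$$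 $$\varepsilon_1=(\alpha\lambda)^{p+1}+(1-\alpha-\alpha\lambda)^{p+1},\qquad \varepsilon_2=(\alpha\lambda)^{p+1}-(\alpha\lambda-1+\alpha)^{p+1},$$ $$\varepsilon_3=[\lambda(1-\alpha)]^{p+1}+[\alpha-\lambda(1-\alpha)]^{p+1},\qquad \varepsilon_4=[\lambda(1-\alpha)]^{p+1}-[\lambda(1-\alpha)-\alpha]^{p+1}.$$
   Context: A function $g$ on an interval $K$ is called $h$-concave on $K$ if $g$ is non-negative and for all $x,y\in K$ and $t\in(0,1)$ one has $g(tx+(1-t)y)\ge h(t)g(x)+h(1-t)g(y)$. $L[c,d]$ denotes the (Lebesgue) integrable functions on $[c,d]$. Each $\varepsilon_i$ is only used in cases where the bases of its powers are non-negative. *)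

(* Defs.v *)
From HB Require Import structures.
From mathcomp Require Import all_boot all_order all_algebra.
From mathcomp Require Import all_classical all_reals all_analysis.

Set Implicit Arguments.
Unset Strict Implicit.
Unset Printing Implicit Defensive.

Import Order.TTheory GRing.Theory Num.Theory.
Import numFieldNormedType.Exports.

Local Open Scope classical_set_scope.
Local Open Scope ring_scope.

(* Functions on an interval of R are total functions R -> R; only their values
   on that interval are meant to matter. *)

(* The completed measure is used because [lebesgue_measure] lives on the Borel
   sigma-algebra, and members of L[c,d] need only be Lebesgue measurable.
   Values at the endpoints c and d are irrelevant, as {c, d} is null. *)
Definition in_L (R : realType) (c d : R) (g : R -> R) : Prop :=
  (@completed_lebesgue_measure R).-integrable `[c, d] (fun x => (g x)%:E).

Definition h_concave (R : realType) (h : R -> R) (K : set R) (g : R -> R)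
    : Prop :=
  (forall x, K x -> 0 <= g x) /\
  (forall x y t, K x -> K y -> 0 < t < 1 ->
     h t * g x + h (1 - t) * g y <= g (t * x + (1 - t) * y)).

(* The left-hand side uses the plain Lebesgue measure: f is continuous, hence
   Borel, on [a,b] in every intended use. *)
Definition lhs (R : realType) (f : R -> R) (a b alpha lambda : R) : R :=
  `| lambda * (alpha * f a + (1 - alpha) * f b)
     + (1 - lambda) * f (alpha * a + (1 - alpha) * b)
     - (b - a)^-1 * \int[@lebesgue_measure R]_(x in `[a, b]) f x |.

Definition E_term (R : realType) (f : R -> R) (a b alpha q : R) : R :=
  (1 - alpha) * `| derive1 f (((1 - alpha) * b + (1 + alpha) * a) / 2) | `^ q.

Definition F_term (R : realType) (f : R -> R) (a b alpha q : R) : R :=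
  alpha * `| derive1 f (((2 - alpha) * b + alpha * a) / 2) | `^ q.

(* [powR] takes a junk value on negative bases; each of the following is meant
   to be used only where all bases are non-negative. *)
Definition eps1 (R : realType) (alpha lambda p : R) : R :=
  (alpha * lambda) `^ (p + 1) + (1 - alpha - alpha * lambda) `^ (p + 1).

Definition eps2 (R : realType) (alpha lambda p : R) : R :=
  (alpha * lambda) `^ (p + 1) - (alpha * lambda - 1 + alpha) `^ (p + 1).

Definition eps3 (R : realType) (alpha lambda p : R) : R :=
  (lambda * (1 - alpha)) `^ (p + 1)
  + (alpha - lambda * (1 - alpha)) `^ (p + 1).

Definition eps4 (R : realType) (alpha lambda p : R) : R :=
  (lambda * (1 - alpha)) `^ (p + 1)
  - (lambda * (1 - alpha) - alpha) `^ (p + 1).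

(* Main.v *)
Require Import Defs.
From HB Require Import structures.
From mathcomp Require Import all_boot all_order all_algebra.
From mathcomp Require Import all_classical all_reals all_analysis.
From mathcomp Require Import ring lra.

Set Implicit Arguments.
Unset Strict Implicit.
Unset Printing Implicit Defensive.

Import Order.TTheory GRing.Theory Num.Theory.
Import numFieldNormedType.Exports.

Local Open Scope classical_set_scope.
Local Open Scope ring_scope.

(* Put c = alpha a + (1 - alpha) b and w = b - a. With s1 = a + alpha lambda w
   and s2 = b - lambda (1 - alpha) w, integration by parts writes w times the
   left-hand side as the sum of the integrals of (x - s1) f' over [a, c] and of
   (x - s2) f' over [c, b]. Each is bounded by Hoelder's inequality together
   with the Hermite-Hadamard inequality for |f'|^q, which comes from
   g(x) + g(u + v - x) <= g((u + v) / 2) / h(1/2) on [u, v].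

   The derivative f' is never integrated: these integrals are increments of
   (x - s) f(x) - Phi(x), with Phi a primitive of f, and the Hoelder bound on
   increments follows from pointwise Young inequalities by monotonicity. *)

(** * Signed powers as primitives of absolute powers *)

Lemma is_derive1_reflect (R : realType) (f : R -> R) (k x df : R) :
  is_derive (k - x) 1 f df -> is_derive x 1 (fun y => f (k - y)) (- df).
Proof.
move=> fdf.
have kdf : is_derive x 1 (fun y => k - y) (-1).
  have : is_derive x 1 (cst k - id) (0 - 1 : R) by exact: is_deriveB.
  by rewrite sub0r.
have := @is_derive1_comp _ f (fun y => k - y) x df (-1) fdf kdf.
by rewrite mulrN1.
Qed.

(** The odd primitive of [|y| ^ p]: the integral of [|x - s| ^ p] is an increment of it, with no
    case split on the position of [s]. *)
Definition signed_powR (R : realType) (p y : R) : R := y * `|y| `^ p / (p + 1).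

Lemma signed_powRN (R : realType) (p y : R) :
  signed_powR p (- y) = - signed_powR p y.
Proof. by rewrite /signed_powR normrN !mulNr. Qed.

Lemma ger0_signed_powR (R : realType) (p y : R) : 0 < p -> 0 <= y ->
  signed_powR p y = y `^ (p + 1) / (p + 1).
Proof.
move=> p0 y0; rewrite /signed_powR ger0_norm//.
have := @mulr_powRB1 _ y (p + 1) y0; rewrite addrK => -> //.
by rewrite addr_gt0.
Qed.

Lemma is_derive_signed_powR (R : realType) (p y : R) : 1 <= p ->
  is_derive y 1 (signed_powR p) (`|y| `^ p).
Proof.
move=> p1; have p0 : 0 < p by lra.
have pos (z : R) : 0 < z -> is_derive z 1 (signed_powR p) (`|z| `^ p).
  move=> z0.
  have dpow := is_derive1_powR (p + 1) z0.
  have dZ : is_derive z 1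
      ((p + 1)^-1 \*: (fun t : R => t `^ (p + 1))) (`|z| `^ p).
    apply: is_derive_eq.
    by rewrite addrK gtr0_norm// /GRing.scale/= mulrA mulVf ?mul1r//; lra.
  apply: near_eq_is_derive dZ; near=> t.
  rewrite /= ger0_signed_powR//; first by rewrite mulrC.
  by apply/ltW; near: t; exact: lt_nbhsr.
have [y0|y0|->] := ltgtP y 0; last first.
(* At 0 the difference quotient is [|h| ^ p / (p + 1)], which is at most [|h|] once [|h| < 1],
   because [p >= 1]. *)
- rewrite normr0 powR0 ?gt_eqF//.
  suff cv : (fun h : R => h^-1 *:
      ((signed_powR p \o shift 0) (h *: (1 : R)) - signed_powR p 0)) @ 0^'
      --> (0 : R).
    split; first by apply/cvg_ex; exists 0.
    by apply/cvg_lim.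
  apply/cvgr0Pnorm_lt => e e0; near=> h.
  have h0 : h != 0 by near: h; exact: nbhs_dnbhs_neq.
  rewrite /= /GRing.scale/= addr0 mulr1 /signed_powR mul0r mul0r subr0.
  rewrite mulrA mulKf// normrM.
  have he : `|h| < Num.min 1 e.
    by near: h; apply: dnbhs0_lt; rewrite lt_min ltr01.
  move: he; rewrite lt_min => /andP[h1 he].
  rewrite ger0_norm ?powR_ge0//.
  have -> : `|(p + 1)^-1| = (p + 1)^-1 by rewrite ger0_norm// invr_ge0; lra.
  apply: (@le_lt_trans _ _ (`|h|)) => //.
  apply: (@le_trans _ _ (`|h| `^ p)).
    rewrite ler_piMr ?powR_ge0// invf_le1; lra.
  by apply: ge1r_powR => //; rewrite normr_gt0 h0 ltW.
- exact: pos.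
(* Negative [y] follows from the positive case by oddness. *)
- have /is_derive1_reflect/is_deriveN :
      is_derive (0 - y) 1 (signed_powR p) (`|y| `^ p).
    by rewrite sub0r -[`|y|]normrN; apply: pos; rewrite oppr_gt0.
  rewrite opprK; congr (is_derive _ _ _ _); apply/funext => t /=.
  by rewrite fctE sub0r signed_powRN opprK.
Unshelve. all: by end_near. Qed.

Lemma signed_powR_increasing (R : realType) (p : R) : 0 < p ->
  {homo signed_powR p : x y / x < y}.
Proof.
move=> p0.
have p10 : 0 < p + 1 by lra.
have pos (y : R) : 0 < y -> 0 < signed_powR p y.
  by move=> y0; rewrite ger0_signed_powR ?(ltW y0)// divr_gt0// powR_gt0.
have pos_lt (x y : R) : 0 <= x -> x < y -> signed_powR p x < signed_powR p y.
  move=> x0 xy; have y0 := le_lt_trans x0 xy.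
  rewrite !ger0_signed_powR// ?(ltW y0)// ltr_pM2r ?invr_gt0//.
  by apply: gt0_ltr_powR; rewrite ?nnegrE// ltW.
move=> x y xy; have [x0|x0] := leP 0 x; first exact: pos_lt.
have [y0|y0] := ltP 0 y.
  apply: (@lt_trans _ _ 0); last exact: pos.
  by rewrite -oppr_gt0 -signed_powRN pos// oppr_gt0.
by rewrite -ltrN2 -!signed_powRN pos_lt ?oppr_ge0// ltrN2.
Qed.

(** * Hoelder's inequality for increments *)

(** If [X > 0], the choice [e = (X / (2 c)) ^ (1 / r)] would give [X <= X / 2]. This passage to the
    limit serves the degenerate case of Hoelder's inequality. *)
Lemma le0_of_powR_le (R : realType) (X c r : R) : 0 < r ->
  (forall e : R, 0 < e -> X <= c * e `^ r) -> X <= 0.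
Proof.
move=> r0 H; rewrite leNgt; apply/negP => X0.
have c0 : 0 < c.
  by have := H 1 ltr01; rewrite powR1 mulr1; exact: lt_le_trans.
have Xc0 := divr_gt0 X0 (mulr_gt0 (ltr0Sn _ 1) c0).
have := H ((X / (2 * c)) `^ r^-1) (powR_gt0 _ Xc0).
rewrite -powRrM mulVf ?gt_eqF// powRr1; last exact: ltW.
have -> : c * (X / (2 * c)) = X / 2 by field; rewrite gt_eqF.
by lra.
Qed.

(** Young's inequality for [x / A ^ (1 / p)] and [y / B ^ (1 / q)]. When [A] and [B] are the
    integrals of [x ^ p] and [y ^ q], the last factor integrates to [1 / p + 1 / q = 1], which is
    Hoelder's inequality. *)
Lemma weighted_young (R : realType) (x y A B p q : R) :
  0 <= x -> 0 <= y -> 0 < A -> 0 < B -> 0 < p -> 0 < q -> p^-1 + q^-1 = 1 ->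
  x * y <= A `^ p^-1 * B `^ q^-1 * (x `^ p / (p * A) + y `^ q / (q * B)).
Proof.
move=> x0 y0 A0 B0 p0 q0 pq.
have Ap := powR_gt0 p^-1 A0; have Bq := powR_gt0 q^-1 B0.
have := @conjugate_powR _ (x / A `^ p^-1) (y / B `^ q^-1) _ _
  (divr_ge0 x0 (ltW Ap)) (divr_ge0 y0 (ltW Bq)) p0 q0 pq.
have scale (z C r : R) : 0 <= z -> 0 < C -> 0 < r ->
    (z / C `^ r^-1) `^ r / r = z `^ r / (r * C).
  move=> z0 C0 r0; rewrite powRM ?invr_ge0 ?powR_ge0//.
  rewrite -powRN -powRrM mulNr mulVf ?gt_eqF// powR_inv1 ?ltW//.
  by field; rewrite !gt_eqF.
rewrite (congr2 +%R (scale _ _ _ x0 A0 p0) (scale _ _ _ y0 B0 q0)) => H.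
apply: le_trans (ler_wpM2l (ltW (mulr_gt0 Ap Bq)) H).
by rewrite le_eqVlt; apply/orP; left; apply/eqP; field; rewrite !gt_eqF.
Qed.

Lemma ge0_derive_le (R : realType) (T dT : R -> R) (u v : R) : u <= v ->
  (forall x, u <= x <= v -> is_derive x 1 T (dT x)) ->
  (forall x, u <= x <= v -> 0 <= dT x) -> T u <= T v.
Proof.
move=> uv TdT dT0.
have [x||c cuv eq] := @MVT_segment _ T dT u v uv.
- by rewrite in_itv/= => /andP[ux xv]; apply: TdT; rewrite !ltW.
- apply: derivable_within_continuous => z.
  by rewrite in_itv/= => /TdT[].
move: cuv; rewrite in_itv/= => /dT0 dc0.
by rewrite -subr_ge0 eq mulr_ge0// subr_ge0.
Qed.

(* Symmetrising about the midpoint makes the hypothesis on [psi] pointwise, so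
   that Young's inequality can be integrated by comparing derivatives. *)
Lemma increment_le_hoelder (R : realType) (G dG P phi psi : R -> R)
    (u v B p q : R) :
  u < v -> 0 < p -> 0 < q -> p^-1 + q^-1 = 1 -> P u < P v ->
  (forall x, u <= x <= v -> is_derive x 1 G (dG x)) ->
  (forall x, u <= x <= v -> is_derive x 1 P (phi x `^ p)) ->
  (forall x, u <= x <= v -> 0 <= phi x) ->
  (forall x, u <= x <= v -> 0 <= psi x) ->
  (forall x, u <= x <= v -> `|dG x| <= phi x * psi x) ->
  (forall x, u <= x <= v -> psi x `^ q + psi (u + v - x) `^ q <= 2 * B) ->
  `|G v - G u| <= (P v - P u) `^ p^-1 * ((v - u) * B) `^ q^-1.
Proof.
move=> uv p0 q0 pq; rewrite -subr_gt0 => A0 GdG Pphi phi0 psi0 dGle psiB.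
set A := P v - P u in A0 *.
have B0 : 0 <= B.
  have := psiB u; rewrite lexx ltW// => /(_ isT).
  have := powR_ge0 (psi u) q; have := powR_ge0 (psi (u + v - u)) q; lra.
have vu0 : 0 < v - u by rewrite subr_gt0.
(* Young's inequality divides by its weights, so [B], which may vanish, is first replaced by a
   positive [C]. *)
have bound C : 0 < C -> B <= C ->
    `|G v - G u| <= A `^ p^-1 * ((v - u) * C) `^ q^-1.
  move=> C0 BC; have vuC := mulr_gt0 vu0 C0.
  set M := A `^ p^-1 * ((v - u) * C) `^ q^-1.
  have M0 : 0 <= M by rewrite mulr_ge0 ?powR_ge0.
  have dGM x : u <= x <= v -> `|dG x| <=
      M * (phi x `^ p / (p * A) + psi x `^ q / (q * ((v - u) * C))).
    move=> uxv; apply: (le_trans (dGle _ uxv)).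
    by apply: weighted_young => //; [exact: phi0|exact: psi0].
  pose m := (u + v) / 2.
  have half (e : R) : `|e| = 1 -> e * (G v - G u) <= M.
    move=> e1.
    (* [T] is the integrated gap in Young's inequality over the segment from [u + v - x] to [x], up
       to a constant. The reflected differences vanish at [m], and at [v] they are the full
       increments; [dT >= 0] adds the pointwise bounds at [x] and at its mirror image. *)
    pose T x := M / (p * A) * (P x - P (u + v - x))
      + M / (q * ((v - u) * C)) * (2 * B) * x
      - e * (G x - G (u + v - x)).
    pose dT x := M / (p * A) * (phi x `^ p + phi (u + v - x) `^ p)
      + M / (q * ((v - u) * C)) * (2 * B)
      - e * (dG x + dG (u + v - x)).
    have : T m <= T v.
      apply: (@ge0_derive_le _ _ dT) => [|x /andP[mx xv]|x /andP[mx xv]].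
      - by rewrite /m; lra.
      - have x1 : u <= x <= v by rewrite /m in mx; lra.
        have x2 : u <= u + v - x <= v by rewrite /m in mx; lra.
        have dP := Pphi _ x1; have dP' := is_derive1_reflect (Pphi _ x2).
        have dG1 := GdG _ x1; have dG2 := is_derive1_reflect (GdG _ x2).
        have -> : T = M / (p * A) \*: (P - (fun x => P (u + v - x)))
           + (M / (q * ((v - u) * C)) * (2 * B)) \*: id
           - e \*: (G - (fun x => G (u + v - x))).
          by [].
        apply: is_derive_eq; rewrite /dT /GRing.scale/= mulr1.
        by rewrite !opprK.
      - have x1 : u <= x <= v by rewrite /m in mx; lra.
        have x2 : u <= u + v - x <= v by rewrite /m in mx; lra.
        have edG y : e * dG y <= `|dG y|.
          by rewrite (le_trans (ler_norm _))// normrM e1 mul1r.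
        have := edG x; have := edG (u + v - x).
        have := dGM _ x1; have := dGM _ x2.
        have : M / (q * ((v - u) * C)) * (psi x `^ q + psi (u + v - x) `^ q)
            <= M / (q * ((v - u) * C)) * (2 * B).
          by rewrite ler_wpM2l ?psiB// divr_ge0// mulr_ge0 ?ltW.
        rewrite /dT; lra.
    have -> : T m = M / (q * ((v - u) * C)) * (2 * B) * m.
      rewrite /T; have -> : u + v - m = m by rewrite /m; lra.
      by rewrite !subrr !mulr0 add0r subr0.
    rewrite /T addrK -/A -subr_ge0.
    have -> : M / (p * A) * A = M * p^-1 by field; rewrite !gt_eqF.
    have MB : M / (q * ((v - u) * C)) * (2 * B) * (v - m) <= M * q^-1.
      have -> : M / (q * ((v - u) * C)) * (2 * B) * (v - m) = M * q^-1 * (B / C).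
        by rewrite /m; field; rewrite !gt_eqF.
      rewrite ler_piMr ?mulr_ge0 ?powR_ge0 ?invr_ge0 ?(ltW q0)//.
      by rewrite ler_pdivrMr// mul1r.
    have : M * p^-1 + M * q^-1 = M by rewrite -mulrDr pq mulr1.
    move: MB; rewrite mulrBr; lra.
  rewrite ler_norml lerNl -mulN1r half ?normrN1//=.
  by rewrite -[leLHS]mul1r half ?normr1.
(* If [B = 0], [bound] applies with [C = e / (v - u)] for every [e > 0], and [e] tends to 0. *)
move: B0; rewrite le_eqVlt => /predU1P[B0|B0]; last exact: bound.
rewrite -B0 mulr0 powR0 ?invr_eq0 ?gt_eqF// mulr0.
have qi0 : 0 < q^-1 by rewrite invr_gt0.
apply: (@le0_of_powR_le _ _ (A `^ p^-1) _ qi0) => e e0.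
have := bound (e / (v - u)); rewrite divr_gt0//= -B0 divr_ge0 ?(ltW e0) ?(ltW vu0)//.
by move=> /(_ isT isT); rewrite mulrCA divff ?gt_eqF// mulr1.
Qed.

(** * A primitive of a continuous function *)

(** Integrating from [a0 < a], with continuity up to [b0 > b], makes the primitive differentiable
    from both sides at [a] and [b] as well. *)
Lemma continuous_primitive (R : realType) (f : R -> R) (a0 a b b0 : R) :
  a0 < a -> a < b -> b < b0 -> {within `[a0, b0], continuous f} ->
  exists2 Phi : R -> R,
    (forall x, a <= x <= b -> is_derive x 1 Phi (f x)) &
    \int[@lebesgue_measure R]_(x in `[a, b]) f x = Phi b - Phi a.
Proof.
move=> a0a ab bb0 cf.
have fi : (@lebesgue_measure R).-integrable `[a0, b0] (EFin \o f).
  by apply: continuous_compact_integrable => //; exact: segment_compact.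
exists (fun x => \int[@lebesgue_measure R]_(t in `[a0, x]) f t).
  move=> x /andP[ax xb].
  have xb0 : x < b0 by lra.
  have a0x : a0 < x by lra.
  have cx : {for x, continuous f}.
    have a0b0 : a0 < b0 by lra.
    by apply: (within_continuous_continuous a0b0 cf); rewrite in_itv/= a0x xb0.
  have [d1 d2] := continuous_FTC1_closed xb0 fi a0x cx.
  apply: DeriveDef; first exact: d1.
  by rewrite -derive1E; exact: d2.
have fi' : (@lebesgue_measure R).-integrable `[a0, b] (EFin \o f).
  by apply: integrableS fi => //; apply: subset_itvl; rewrite bnd_simp ltW.
rewrite (Rintegral_itvB fi')//; last 2 first.
- by rewrite bnd_simp ltW.
- by rewrite bnd_simp ltW.
rewrite Rintegral_itv_obnd_cbnd//.
by apply: integrableS fi' => //; apply: subset_itvr; rewrite bnd_simp ltW.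
Qed.

(** * Kernel moments and their Hoelder bounds *)

(** The integral of [|x - s| ^ p] over an interval of length [w * k] containing [s], at distance
    [w * y] from one end; it yields [eps1] and [eps3]. *)
Lemma signed_powR_kernel_le (R : realType) (p w y k : R) :
  0 < p -> 0 < w -> 0 <= y <= k ->
  signed_powR p (w * y) + signed_powR p (w * (k - y))
  = w `^ (p + 1) * (y `^ (p + 1) + (k - y) `^ (p + 1)) / (p + 1).
Proof.
move=> p0 w0 /andP[y0 yk]; have ky0 : 0 <= k - y by rewrite subr_ge0.
rewrite !ger0_signed_powR ?mulr_ge0 ?(ltW w0)// !powRM ?(ltW w0)//.
by rewrite -mulrDl -mulrDr.
Qed.

(** Here [s] lies at or beyond the far end of the interval, so the second term changes sign; this
    yields [eps2] and [eps4]. *)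
Lemma signed_powR_kernel_ge (R : realType) (p w y k : R) :
  0 < p -> 0 < w -> 0 <= k <= y ->
  signed_powR p (w * y) + signed_powR p (w * (k - y))
  = w `^ (p + 1) * (y `^ (p + 1) - (y - k) `^ (p + 1)) / (p + 1).
Proof.
move=> p0 w0 /andP[k0 ky]; have yk0 : 0 <= y - k by rewrite subr_ge0.
have y0 := le_trans k0 ky.
rewrite -(opprB y k) mulrN signed_powRN.
rewrite !ger0_signed_powR ?mulr_ge0 ?(ltW w0)// !powRM ?(ltW w0)//.
by rewrite -mulrBl -mulrBr.
Qed.

(** The exponents of [w] add up to [(p + 1) / p + 1 / q = 2]. One factor [w] later cancels the
    [1 / (b - a)] of the mean value; the other is the prefactor [b - a]. *)
Lemma hoelder_product_scaling (R : realType) (p q w e k G H : R) :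
  0 < p -> 1 / p + 1 / q = 1 -> 0 < w -> 0 <= e -> 0 <= k -> 0 <= G -> 0 < H ->
  (w `^ (p + 1) * e / (p + 1)) `^ (1 / p) * (k * w * (G / (2 * H))) `^ (1 / q)
  = w ^+ 2 * ((1 / (2 * H)) `^ (1 / q) * (1 / (p + 1)) `^ (1 / p)
              * (e `^ (1 / p) * (k * G) `^ (1 / q))).
Proof.
move=> p0 pq w0 e0 k0 G0 H0.
have p10 : 0 <= 1 / (p + 1) by rewrite divr_ge0//; lra.
have H20 : 0 <= 1 / (2 * H) by rewrite divr_ge0// mulr_ge0 ?ltW.
have kG0 : 0 <= k * G by rewrite mulr_ge0.
have -> : w `^ (p + 1) * e / (p + 1) = w `^ (p + 1) * (e * (1 / (p + 1))).
  by field; lra.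
have -> : k * w * (G / (2 * H)) = w * (k * G * (1 / (2 * H))).
  by field; rewrite gt_eqF.
move: (1 / (2 * H)) (1 / (p + 1)) H20 p10 => X Y X0 Y0.
rewrite !powRM ?powR_ge0 ?mulr_ge0 ?(ltW w0)//.
have -> : w ^+ 2 = (w `^ (p + 1)) `^ (1 / p) * w `^ (1 / q).
  rewrite -powRrM -powRD; last by rewrite (gt_eqF w0) implybT.
  have -> : (p + 1) * (1 / p) + 1 / q = 2%:R.
    by rewrite -[1 / q](addrK (1 / p)) (addrC (1 / q)) pq; field; rewrite gt_eqF.
  by rewrite powR_mulrn// ltW.
by ring.
Qed.

(** [(x - s) f(x) - Phi(x)] has derivative [(x - s) f'(x)], to which the Hoelder bound applies with
    factors [|x - s|] and [|f'(x)|]. The case [u = v] is kept because a piece degenerates when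
    [alpha] is 0 or 1. *)
Lemma moment_increment_le (R : realType) (f Phi : R -> R) (u v s B p q : R) :
  u <= v -> 1 <= p -> 0 < q -> 1 / p + 1 / q = 1 ->
  (forall x, u <= x <= v -> derivable f x 1) ->
  (forall x, u <= x <= v -> is_derive x 1 Phi (f x)) ->
  (forall x, u <= x <= v ->
     `|derive1 f x| `^ q + `|derive1 f (u + v - x)| `^ q <= 2 * B) ->
  `|((v - s) * f v - Phi v) - ((u - s) * f u - Phi u)|
  <= (signed_powR p (v - s) - signed_powR p (u - s)) `^ (1 / p)
     * ((v - u) * B) `^ (1 / q).
Proof.
rewrite le_eqVlt => /predU1P[-> *|uv p1 q0].
  by rewrite subrr normr0 mulr_ge0 ?powR_ge0.
rewrite !div1r => pq df dPhi fB.
have p0 : 0 < p by lra.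
have shiftD (x : R) : is_derive x 1 (fun x : R => x - s) 1.
  have : is_derive x 1 (id - cst s : R -> R) (1 - 0 : R) by exact: is_deriveB.
  by rewrite subr0.
apply: (@increment_le_hoelder _ (fun x => (x - s) * f x - Phi x)
  (fun x => (x - s) * derive1 f x) (fun x => signed_powR p (x - s))
  (fun x => `|x - s|) (fun x => `|derive1 f x|)) => //.
- by apply: signed_powR_increasing => //; rewrite ltrD2r.
- move=> x uxv; have dfx := derivableP (df _ uxv); have dPx := dPhi _ uxv.
  have dsx := shiftD x.
  have H : is_derive x 1 ((fun x => x - s) * f - Phi) ((x - s) * derive1 f x).
    apply: is_derive_eq.
    by rewrite derive1E /GRing.scale/= mulr1; ring.
  exact: H.
- move=> x _; have dsx := shiftD x.
  have dp := is_derive_signed_powR (x - s) p1.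
  by have := @is_derive1_comp _ _ (fun x => x - s) _ _ _ dp dsx; rewrite mulr1.
- by move=> x _; rewrite normrM.
Qed.

(** * The midpoint inequality, and room around the segment *)

(** [h]-concavity at [t = 1 / 2], since [x] and [u + v - x] always average to the midpoint. The
    right-hand side has the shape [2 * B] that the Hoelder bound expects. *)
Lemma h_concave_midpoint (R : realType) (h g : R -> R) (a b u v : R) :
  h_concave h `[a, b]%classic g -> 0 < h (1 / 2) -> a <= u -> v <= b ->
  forall x, u <= x <= v ->
  g x + g (u + v - x) <= 2 * (g ((u + v) / 2) / (2 * h (1 / 2))).
Proof.
move=> [_ gh] h0 au vb x /andP[ux xv].
have xab : (`[a, b]%classic : set R) x by rewrite /= in_itv/=; lra.
have yab : (`[a, b]%classic : set R) (u + v - x) by rewrite /= in_itv/=; lra.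
have t01 : 0 < (1 / 2 : R) < 1 by lra.
have := gh _ _ _ xab yab t01.
have -> : 1 - 1 / 2 = 1 / 2 :> R by lra.
have -> : 1 / 2 * x + 1 / 2 * (u + v - x) = (u + v) / 2 by lra.
rewrite -mulrDr => H.
have -> : 2 * (g ((u + v) / 2) / (2 * h (1 / 2))) = g ((u + v) / 2) / h (1 / 2).
  by field; rewrite gt_eqF.
by rewrite ler_pdivlMr// mulrC.
Qed.

Lemma interior_itv_segment (R : realType) (I : set R) (a b : R) :
  is_interval I -> interior I a -> interior I b -> a < b ->
  exists a0 b0, [/\ a0 < a, b < b0 & forall x, a0 <= x <= b0 -> interior I x].
Proof.
move=> Iitv aI bI ab.
have /nbhs_ballP[e /= e0 ae] := aI.
have /nbhs_ballP[d /= d0 bd] := bI.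
(* Quarter radii leave every such [x] inside the open interval with half radii, whose endpoints
   still belong to [I]. *)
exists (a - e / 2 / 2), (b + d / 2 / 2); split; [lra|lra|move=> x /andP[ax xb]].
have : nbhs x (`]a - e / 2, b + d / 2[%classic : set R).
  by apply: near_in_itvoo; rewrite in_itv/=; lra.
apply: filterS => y; rewrite /= in_itv/= => /andP[ay yb].
apply: (Iitv (a - e / 2) (b + d / 2)); last by rewrite !ltW.
- by apply: ae; rewrite /ball/= opprB addrC subrK gtr0_norm; lra.
- by apply: bd; rewrite /ball/= opprD addNKr normrN gtr0_norm; lra.
Qed.

(** * The inequality in its three cases *)

Theorem theorem12 (R : realType) (I J : set R) (h f : R -> R)
    (a b alpha lambda p q : R)
    (I_itv : is_interval I) (J_itv : is_interval J)
    (J01 : `]0, 1[ `<=` J)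
    (h_ge0 : forall x, J x -> 0 <= h x)
    (h_neq0 : exists x, J x /\ h x != 0)
    (h_L : in_L 0 1 h)
    (h_half : h (1 / 2) != 0)
    (f_diff : forall x, interior I x -> derivable f x 1)
    (aI : interior I a) (bI : interior I b) (ab : a < b)
    (f'_L : in_L a b (derive1 f))
    (alpha01 : 0 <= alpha <= 1) (lambda01 : 0 <= lambda <= 1)
    (q_gt1 : 1 < q) (pq : 1 / p + 1 / q = 1)
    (f'_concave : h_concave h `[a, b] (fun x => `| derive1 f x | `^ q)) :
  let bound (eps eps' : R) : R :=
    (b - a) * (1 / (2 * h (1 / 2))) `^ (1 / q) * (1 / (p + 1)) `^ (1 / p) *
    (eps `^ (1 / p) * E_term f a b alpha q `^ (1 / q)
     + eps' `^ (1 / p) * F_term f a b alpha q `^ (1 / q)) in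
  [/\ alpha * lambda <= 1 - alpha <= 1 - lambda * (1 - alpha) ->
        lhs f a b alpha lambda
        <= bound (eps1 alpha lambda p) (eps3 alpha lambda p),
      alpha * lambda <= 1 - lambda * (1 - alpha) <= 1 - alpha ->
        lhs f a b alpha lambda
        <= bound (eps1 alpha lambda p) (eps4 alpha lambda p) &
      1 - alpha <= alpha * lambda <= 1 - lambda * (1 - alpha) ->
        lhs f a b alpha lambda
        <= bound (eps2 alpha lambda p) (eps3 alpha lambda p) ].
Proof.
move=> bound.
have [alpha0 alpha1] := andP alpha01; have [lambda0 lambda1] := andP lambda01.
have q0 : 0 < q by lra.
have p1 : 1 <= p.
  (* Positivity of [1 - q^-1] rules out [p <= 0], including [p = 0], whose inverse is 0 by
     convention. *)
  have ip : p^-1 = 1 - q^-1 by move: pq; rewrite !div1r; lra.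
  have ip0 : 0 < p^-1 by rewrite ip subr_gt0 invf_lt1.
  have p0 : 0 < p by rewrite -invr_gt0.
  by rewrite -invf_le1// ip gerBl invr_ge0 ltW.
have p0 : 0 < p by lra.
have h0 : 0 < h (1 / 2).
  rewrite lt_neqAle eq_sym h_half h_ge0//.
  by apply: J01; rewrite /= in_itv/=; lra.
have [a0 [b0 [a0a bb0 I0]]] := interior_itv_segment I_itv aI bI ab.
have df x : a0 <= x <= b0 -> derivable f x 1 by move=> /I0; exact: f_diff.
have [|Phi dPhi PhiE] := @continuous_primitive _ f _ _ _ _ a0a ab bb0.
  by apply: derivable_within_continuous => x; rewrite in_itv/=; exact: df.
set w := b - a; have w0 : 0 < w by rewrite subr_gt0.
set c := alpha * a + (1 - alpha) * b.
have al0 : 0 <= alpha * w by rewrite mulr_ge0// ltW.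
have al1 : 0 <= (1 - alpha) * w by rewrite mulr_ge0 ?subr_ge0// ltW.
have ac : a <= c.
  by rewrite -subr_ge0; have -> : c - a = (1 - alpha) * w by rewrite /c /w; ring.
have cb : c <= b.
  by rewrite -subr_ge0; have -> : b - c = alpha * w by rewrite /c /w; ring.
have piece u v s : a <= u -> u <= v -> v <= b ->
    `|((v - s) * f v - Phi v) - ((u - s) * f u - Phi u)|
    <= (signed_powR p (v - s) - signed_powR p (u - s)) `^ (1 / p)
       * ((v - u) * (`|derive1 f ((u + v) / 2)| `^ q / (2 * h (1 / 2)))) `^ (1 / q).
  move=> au uv vb; apply: moment_increment_le => //.
  - by move=> x uxv; apply: df; lra.
  - by move=> x uxv; apply: dPhi; lra.
  - exact: (h_concave_midpoint f'_concave h0 au vb).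
(* The three cases differ only in the values [e1] and [e2] of the two normalised kernel
   integrals. *)
have key e1 e2 : 0 <= e1 -> 0 <= e2 ->
    signed_powR p (w * (alpha * lambda))
      + signed_powR p (w * (1 - alpha - alpha * lambda))
      = w `^ (p + 1) * e1 / (p + 1) ->
    signed_powR p (w * (lambda * (1 - alpha)))
      + signed_powR p (w * (alpha - lambda * (1 - alpha)))
      = w `^ (p + 1) * e2 / (p + 1) ->
    lhs f a b alpha lambda <= bound e1 e2.
  move=> e10 e20 E1 E2.
  (* With these zeros, [s1 - a], [s2 - s1] and [b - s2] are [w] times the weights of [f a], [f c]
     and [f b] in the left-hand side. *)
  pose s1 := a + alpha * lambda * w; pose s2 := b - lambda * (1 - alpha) * w.
  have := piece a c s1 (lexx _) ac cb.
  have := piece c b s2 ac cb (lexx _).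
  have -> : c - s1 = w * (1 - alpha - alpha * lambda) by rewrite /s1 /c /w; ring.
  have -> : a - s1 = - (w * (alpha * lambda)) by rewrite /s1; ring.
  have -> : b - s2 = w * (lambda * (1 - alpha)) by rewrite /s2; ring.
  have -> : c - s2 = - (w * (alpha - lambda * (1 - alpha))).
    by rewrite /s2 /c /w; ring.
  have -> : c - a = (1 - alpha) * w by rewrite /c /w; ring.
  have -> : b - c = alpha * w by rewrite /c /w; ring.
  have -> : (a + c) / 2 = ((1 - alpha) * b + (1 + alpha) * a) / 2.
    by rewrite /c; congr (_ / _); ring.
  have -> : (c + b) / 2 = ((2 - alpha) * b + alpha * a) / 2.
    by rewrite /c; congr (_ / _); ring.
  rewrite !signed_powRN !opprK [X in _ <= X `^ _ * _ -> _ -> _]E2.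
  rewrite (addrC (signed_powR p (w * (1 - _ - _)))) E1.
  have k0 : 0 <= 1 - alpha by rewrite subr_ge0.
  rewrite (hoelder_product_scaling p0 pq w0 e20 alpha0 (powR_ge0 _ _) h0).
  rewrite (hoelder_product_scaling p0 pq w0 e10 k0 (powR_ge0 _ _) h0).
  move=> D2le D1le.
  set D2 := (X in `|X| <= _) in D2le; set D1 := (X in `|X| <= _) in D1le.
  (* The integration by parts identity: [Phi c] cancels between the two increments, leaving the
     integral of [f]. *)
  have SE : lhs f a b alpha lambda = w^-1 * `|D1 + D2|.
    rewrite -[X in X * _]gtr0_norm ?invr_gt0// -normrM /lhs PhiE.
    congr (`|_|); rewrite /D1 /D2 -/c -/w /w; field.
    by rewrite subr_eq0 gt_eqF.
  rewrite SE mulrC ler_pdivrMr//.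
  rewrite (le_trans (ler_normD _ _))// (le_trans (lerD D1le D2le))//.
  rewrite /bound -/w le_eqVlt; apply/orP; left; apply/eqP.
  rewrite /E_term /F_term.
  move: ((1 / (2 * h (1 / 2))) `^ _) ((1 / (p + 1)) `^ _) => X Y.
  move: (e1 `^ _ * _) (e2 `^ _ * _) => U V.
  by ring.
have eps_le y k : 0 <= y `^ (p + 1) + (k - y) `^ (p + 1).
  by rewrite addr_ge0 ?powR_ge0.
have eps_ge y k : 0 <= k <= y -> 0 <= y `^ (p + 1) - (y - k) `^ (p + 1).
  move=> /andP[k0 ky]; rewrite subr_ge0 ge0_ler_powR ?nnegrE//; lra.
have al_ge0 : 0 <= alpha * lambda by rewrite mulr_ge0.
have la_ge0 : 0 <= lambda * (1 - alpha) by rewrite mulr_ge0 ?subr_ge0.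
have eps2E : eps2 alpha lambda p = (alpha * lambda) `^ (p + 1)
    - (alpha * lambda - (1 - alpha)) `^ (p + 1).
  by rewrite /eps2 opprB addrA addrAC.
(* The case conditions say whether [s1] lies in [[a, c]], that is [alpha * lambda <= 1 - alpha], and
   whether [s2] lies in [[c, b]], that is [lambda * (1 - alpha) <= alpha]. *)
split=> /andP[c1 c2]; apply: key.
- exact: eps_le.
- exact: eps_le.
- by apply: signed_powR_kernel_le => //; lra.
- by apply: signed_powR_kernel_le => //; lra.
- exact: eps_le.
- by apply: eps_ge; lra.
- by apply: signed_powR_kernel_le => //; lra.
- by apply: signed_powR_kernel_ge => //; lra.
- by rewrite eps2E; apply: eps_ge; lra.
- exact: eps_le.
- by rewrite eps2E; apply: signed_powR_kernel_ge => //; lra.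
- by apply: signed_powR_kernel_le => //; lra.
Qed.
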